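(* Let $\pi\in\mathcal P_2(\mathbb R^d)$, let $K$ be a positive integer and let $\mathbf p=(p_1,\dots,p_K)$ satisfy $p_k>0$ and $\sum_{k=1}^Kp_k=1$. Let $L$ be the variance loss $L(\mu)=\int_{\mathbb R^d}\langle\mathbf x-\mathbb E_\mu[X],W(\mathbf x-\mathbb E_\mu[X])\rangle\,d\mu(\mathbf x)$, where $W$ is a positive semidefinite $d\times d$ diagonal matrix with nonzero diagonal entries. Let $\mu_1,\dots,\mu_K$ be probability densities forming an optimal solution of the optimal decomposition problem with specified weights $\mathbf p$ and loss $L$. Then for any $\delta,c>0$, the collection $\{S_k(\delta,c)\}_{k\in[K]}$ of $(\delta,c)$-interior supports of the $\mu_k$ is convex in pairs, i.e. $\mathrm{conv}(S_i(\delta,c))\cap S_j(\delta,c)=\emptyset$ for all $i\neq j\in[K]$.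
   Context: $[K]=\{1,\dots,K\}$. $\mathcal P_2(\mathbb R^d)$ is the set of Borel probability measures on $\mathbb R^d$ with finite second moment; $\mathcal P_{2,ac}(\mathbb R^d)$ is the subset of those absolutely continuous with respect to Lebesgue measure; a measure and its density are denoted by the same symbol. $\mathbb E_\mu[X]$ is the mean of $\mu$, and $\mathrm{conv}$ denotes the convex hull. Optimal decomposition problem with specified weights: given $\pi$, $K$, $\mathbf p$ and $L$, minimize $F_{\mathbf p}(\boldsymbol\mu)=\sum_{k\in[K]}p_kL(\mu_k)$ over $\boldsymbol\mu=(\mu_1,\dots,\mu_K)\in\mathcal P_2(\mathbb R^d)^{K}$ such that $\sum_{k\in[K]}p_k\mu_k=\pi$ (equality of measures). $(\delta,c)$-interior support: for $\delta,c>0$, the $(\delta,c)$-interior support of a density $\mu\in\mathcal P_{2,ac}(\mathbb R^d)$ is the set of all $\mathbf x\in\mathbb R^d$ such that $\mu(\mathbf y)>c$ for all $\mathbf y\in\mathbb R^d$ with $\|\mathbf x-\mathbf y\|\le\delta$. *)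

(* Defs.v *)
From HB Require Import structures.
From mathcomp Require Import all_boot all_order all_algebra.
From mathcomp Require Import all_classical all_reals all_analysis measurable_realfun.

Set Implicit Arguments.
Unset Strict Implicit.
Unset Printing Implicit Defensive.

Import Order.TTheory GRing.Theory Num.Theory.
Import numFieldNormedType.Exports.

Local Open Scope classical_set_scope.
Local Open Scope ring_scope.

(* R^d is the type 'cV[R]_d of column vectors, with its Borel sigma-algebra. *)
Section borel_sigma_algebra.
Variables (R : realType) (d : nat).

Let Borel : set (set 'cV[R]_d) := <<s @open 'cV[R]_d >>.

Let Borel0 : Borel set0. Proof. exact: sigma_algebra0. Qed.

Let BorelC A : Borel A -> Borel (~` A). Proof. exact: sigma_algebraC. Qed.

Let BorelU (F : (set 'cV[R]_d)^nat) :
  (forall i, Borel (F i)) -> Borel (\bigcup_i F i).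
Proof. exact: sigma_algebra_bigcup. Qed.

HB.instance Definition _ :=
  @isMeasurable.Build (sigma_display (@open 'cV[R]_d)) 'cV[R]_d
    Borel Borel0 BorelC BorelU.

End borel_sigma_algebra.

Section cons_cV.
Variable R : realType.

Lemma measurable_coord d (i : 'I_d) :
  measurable_fun [set: 'cV[R]_d] (fun x => x i ord0 : measurableTypeR R).
Proof.
apply: (measurability _ (RGenOInfty.measurableE R)).
move=> _ [_ [a ->] <-]; rewrite setTI; apply: sub_sigma_algebra.
apply: open_comp; last exact: interval_open.
by move=> x _; exact: coord_continuous.
Qed.

Let qbox d (c : 'cV[rat]_d * rat) : set 'cV[R]_d :=
  [set x | forall i, `|x i ord0 - ratr (c.1 i ord0)| < ratr c.2].

Let open_qbox d (U : set 'cV[R]_d) : open U ->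
  U = \bigcup_(c in [set c | qbox c `<=` U]) qbox c.
Proof.
move=> oU; apply/seteqP; split=> [x Ux|x [c cU cx]]; last exact: cU.
have /nbhs_ballP[e /= e0 eU] : nbhs x U by exact: open_nbhs_nbhs.
have [q] := rat_in_itvoo (divr_gt0 e0 (ltr0n R 2)).
rewrite in_itv/= => /andP[q0 qe].
have appr i : exists r : rat, `|x i ord0 - ratr r| < ratr q.
  have [|r] := @rat_in_itvoo R (x i ord0 - ratr q) (x i ord0 + ratr q).
    by rewrite ltrD2l gtrN.
  by rewrite in_itv/= => rq; exists r; rewrite ltr_distlC.
pose c : 'cV[rat]_d := \col_i xchoose (appr i).
have cx i : `|x i ord0 - ratr (c i ord0)| < ratr q.
  by rewrite mxE; exact: (xchooseP (appr i)).
exists (c, q) => //= y cy; apply: eU; split=> // i j.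
rewrite (ord1 j) -ball_normE/= (splitr e).
rewrite (le_lt_trans (ler_distD (ratr (c i ord0)) _ _))// ltrD//.
  exact: lt_trans (cx i) qe.
by rewrite distrC; exact: lt_trans (cy i) qe.
Qed.

Lemma measurable_fun_coordP d' (T : measurableType d') d (f : T -> 'cV[R]_d) :
  (forall i, measurable_fun setT (fun t => f t i ord0 : measurableTypeR R)) ->
  measurable_fun setT f.
Proof.
move=> mf; apply: (@measurability _ _ _ _ _ _ (@open 'cV[R]_d)) => //.
move=> _ [U /open_qbox -> <-]; rewrite setTI preimage_bigcup bigcup_mkcond.
apply: countable_bigcupT_measurable; first exact: countableP.
move=> c; case: ifPn => // _.
rewrite -[X in measurable X]setCK; apply: measurableC.
rewrite (_ : ~` _ = \bigcup_(i in [set: 'I_d])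
    ~` ((fun t => f t i ord0) @^-1` ball (ratr (c.1 i ord0) : R) (ratr c.2))).
  apply: countable_bigcupT_measurable => [|i]; first exact: countableP.
  apply: measurableC; rewrite -[X in measurable X]setTI.
  by apply: mf => //; apply: open_measurable; exact: ball_open.
rewrite -setC_bigcap; congr (~` _); apply/seteqP; split=> t /= ct i => [_|].
  by rewrite -ball_normE/= distrC; exact: ct.
by have := ct i I; rewrite -ball_normE/= distrC.
Qed.

Definition cons_cV d (z : 'cV[R]_d * measurableTypeR R) : 'cV[R]_d.+1 :=
  col_mx (z.2%:M : 'cV[R]_1) z.1.

Lemma measurable_cons_cV d : measurable_fun setT (@cons_cV d).
Proof.
apply: measurable_fun_coordP => i.
case: (@split_ordP 1 d i) => j ->.
  apply: (eq_measurable_fun snd) => // z _.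
  by rewrite /= [RHS]col_mxEu ord1 mxE eqxx mulr1n.
apply: (eq_measurable_fun ((fun x : 'cV[R]_d => x j ord0) \o fst)).
  by move=> z _; rewrite /= [RHS]col_mxEd.
by apply: measurableT_comp => //; exact: measurable_coord.
Qed.

HB.instance Definition _ d :=
  isMeasurableFun.Build _ _ _ _ (@cons_cV d) (@measurable_cons_cV d).

End cons_cV.


Section lebesgue_cV_step.
Context (R : realType) (d : nat) (m : {measure set 'cV[R]_d -> \bar R}).

Definition lebesgue_cV_step : set 'cV[R]_d.+1 -> \bar R :=
  pushforward (m \x lebesgue_measure)%E (@cons_cV R d).

Let step0 : lebesgue_cV_step set0 = 0%E.
Proof. exact: measure0. Qed.

Let step_ge0 A : (0 <= lebesgue_cV_step A)%E.
Proof. exact: measure_ge0. Qed.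

Let step_sigma_additive : semi_sigma_additive lebesgue_cV_step.
Proof.
by apply: measure_semi_sigma_additive.
Qed.

HB.instance Definition _ := isMeasure.Build _ _ _ lebesgue_cV_step
  step0 step_ge0 step_sigma_additive.

End lebesgue_cV_step.

(* Lebesgue measure on R^d, as the d-fold product of Lebesgue measure on R
   carried over to column vectors; see lebesgue_cV_prod. *)
Fixpoint lebesgue_cV (R : realType) (d : nat) :
    {measure set 'cV[R]_d -> \bar R} :=
  match d with
  | 0 => \d_(0 : 'cV[R]_0)
  | d'.+1 => lebesgue_cV_step (lebesgue_cV R d')
  end.

Lemma lebesgue_cV_prod (R : realType) d (A : 'I_d -> set (measurableTypeR R)) :
  (forall i, measurable (A i)) ->
  lebesgue_cV R d [set x | forall i, A i (x i ord0)] =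
    (\prod_(i < d) lebesgue_measure (A i))%E.
Proof.
elim: d A => [|d IHd] A mA.
  by rewrite big_ord0 /= diracE mem_set// => -[].
have mB : measurable [set x : 'cV[R]_d | forall i, A (lift ord0 i) (x i ord0)].
  rewrite (_ : mkset _ = \bigcap_(i in [set: 'I_d])
      ((fun x : 'cV[R]_d => x i ord0 : measurableTypeR R) @^-1` A (lift ord0 i))).
    rewrite -[X in measurable X]setCK setC_bigcap; apply: measurableC.
    apply: countable_bigcupT_measurable => [|i]; first exact: countableP.
    apply: measurableC; rewrite -[X in measurable X]setTI.
    exact: measurable_coord.
  by apply/seteqP; split=> x /= Ax i => [_|]; exact: Ax.
rewrite big_ord_recl -IHd// muleC -(product_measure1E _ _ mB (mA ord0)).
rewrite /lebesgue_cV_step /pushforward; congr (product_measure1 _ _ _).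
have cons0 (z : 'cV[R]_d * measurableTypeR R) : cons_cV z ord0 ord0 = z.2.
  rewrite (_ : ord0 = @lshift 1 d ord0); last exact/val_inj.
  by rewrite [LHS]col_mxEu mxE eqxx mulr1n.
have consS (z : 'cV[R]_d * measurableTypeR R) i :
    cons_cV z (lift ord0 i) ord0 = z.1 i ord0.
  rewrite (_ : lift ord0 i = @rshift 1 d i); last exact/val_inj.
  by rewrite [LHS]col_mxEd.
apply/seteqP; split=> z /=.
  by move=> Az; split=> [i|]; [rewrite -consS|rewrite -cons0]; exact: Az.
move=> [Az1 Az2] i; case: (unliftP ord0 i) => [j|] ->.
  by rewrite consS; exact: Az1.
by rewrite cons0.
Qed.

Section euclidean_space.
Variables (R : realType) (d : nat).
Implicit Types (x y : 'cV[R]_d) (A : set 'cV[R]_d).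

Definition dotv x y : R := (x^T *m y) ord0 ord0.

(* The library norm `|x| on 'cV[R]_d is the sup norm. *)
Definition norm2 x : R := Num.sqrt (dotv x x).

Definition psd (W : 'M[R]_d) : Prop :=
  W^T = W /\ forall x, 0 <= dotv x (W *m x).

(* The intersection of all convex sets containing A. *)
Definition conv A : set 'cV[R]_d := smallest (@convex_set R 'cV[R]_d) A.

Definition convex_in_pairs (K : nat) (S : 'I_K -> set 'cV[R]_d) : Prop :=
  forall i j, i != j -> conv (S i) `&` S j = set0.

Definition interior_support (f : 'cV[R]_d -> R) (delta c : R) : set 'cV[R]_d :=
  [set x | forall y, norm2 (x - y) <= delta -> c < f y].

End euclidean_space.

Section optimal_decomposition.
Variables (R : realType) (d : nat).
Implicit Types (mu pi : probability 'cV[R]_d R) (f : 'cV[R]_d -> R).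

Definition finite_second_moment mu : Prop :=
  (\int[mu]_x (norm2 x ^+ 2)%:E < +oo)%E.

(* fine turns the extended-real expectation into a real number; it loses nothing
   when mu has a finite second moment. *)
Definition mean mu : 'cV[R]_d := \col_i fine 'E_mu[fun x => x i ord0].

Definition variance_loss (W : 'M[R]_d) mu : \bar R :=
  (\int[mu]_x (dotv (x - mean mu) (W *m (x - mean mu)))%:E)%E.

(* f is an arbitrary version of the density of mu; interior supports are
   computed pointwise from that version. *)
Definition is_density mu f : Prop :=
  [/\ measurable_fun setT f,
      forall x, 0 <= f x &
      forall A, measurable A ->
        mu A = (\int[lebesgue_cV R d]_(x in A) (f x)%:E)%E].

Variables (K : nat) (pi : probability 'cV[R]_d R) (p : 'I_K -> R).
Variable L : probability 'cV[R]_d R -> \bar R.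
Implicit Type mus : 'I_K -> probability 'cV[R]_d R.

Definition is_decomposition mus : Prop :=
  (forall k, finite_second_moment (mus k)) /\
  forall A, measurable A -> (\sum_(k < K) (p k)%:E * mus k A)%E = pi A.

Definition objective mus : \bar R := (\sum_(k < K) (p k)%:E * L (mus k))%E.

Definition is_optimal_decomposition mus : Prop :=
  is_decomposition mus /\
  forall nus, is_decomposition nus -> (objective mus <= objective nus)%E.

End optimal_decomposition.

(* Main.v *)
Require Import Defs.
From mathcomp Require Import all_boot all_order all_algebra.
From mathcomp Require Import all_classical all_reals all_analysis.
From mathcomp Require Import measurable_realfun ring lra.

Set Implicit Arguments.
Unset Strict Implicit.
Unset Printing Implicit Defensive.

Import Order.TTheory GRing.Theory Num.Theory.
Import numFieldNormedType.Exports.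

Local Open Scope classical_set_scope.
Local Open Scope ring_scope.

(** Writing [m_k] for the mean of [mu_k], the law of total variance gives
    [sum_k p_k L(mu_k) = int <x, W x> dpi - sum_k p_k <m_k, W m_k>], where the
    first term is the same for every decomposition of [pi].  An optimal
    decomposition is therefore one that maximizes [sum_k p_k <m_k, W m_k>]
    ([optimal_means]).

    Let [P = mu_i] and [Q = mu_j], and let [A] and [B] be Borel sets.  Moving a
    fraction [p_j Q(B)] of the mass of [P] in [A] to the other component, and a
    fraction [p_i P(A)] of the mass of [Q] in [B] the other way, gives again a
    decomposition of [pi].  It changes [m_i] by [p_j D] and [m_j] by [- p_i D],
    where [D = P(A) int_B x dQ - Q(B) int_A x dP].  With
    [w = W (m_i - m_j)], maximality of the sum above becomes
    [2 <w, D> + (p_i + p_j) <D, W D> <= 0] ([optimality_exchange]).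

    Suppose now that [x] is in [S_i] and [y] in [S_j], but [<w, x> <= <w, y>].
    Let [u] be [w], or, if [w = 0], some nonzero vector with [<u, x> <= <u,
    y>]. The densities exceed [c] within distance [delta], so every nonempty
    open set of points this close to [x] has positive [mu_i]-mass, and
    likewise for [y] and [mu_j]. Hence [A] can be chosen near [x] and [B] near
    [y], both of positive mass, with [<u, .>] bounded on [A] by a value
    strictly below its values on [B]. Then [<u, D> > 0], so that [D] is
    nonzero and [<w, D> >= 0]. As [W] is positive definite, this contradicts
    the inequality above. The second-order term [<D, W D>] is what settles the
    case of equal means.

    Consequently [<w, y> < <w, x>] for all [x] in [S_i] and [y] in [S_j]
    ([interior_supports_separated]): each [y] in [S_j] lies outside an open
    half-space that contains [S_i], hence outside the convex hull of [S_i]. *)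

(** * Bilinear forms and half-spaces in coordinates *)

Lemma continuous_sum (R : realType) (T : topologicalType) n
    (F : 'I_n -> T -> R) :
  (forall i, continuous (F i)) -> continuous (fun x => \sum_(i < n) F i x).
Proof.
move=> cF; apply: (@continuous_big R _ +%R) => [|i _]; last exact: cF.
exact: pseudometric_normed_Zmodule.add_continuous.
Qed.

Section coordinates.
Variables (R : realType) (d : nat).
Implicit Types (u v x y z : 'cV[R]_d) (W : 'M[R]_d).

Lemma dotvE u v : dotv u v = \sum_(l < d) u l ord0 * v l ord0.
Proof. by rewrite /dotv mxE; apply: eq_bigr => l _; rewrite mxE. Qed.

Lemma mul_diag_mxE W u l : is_diag_mx W ->
  (W *m u) l ord0 = W l l * u l ord0.
Proof.
move=> /is_diag_mxP Wd; rewrite mxE (bigD1 l)//= big1 ?addr0// => k kl.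
by rewrite Wd ?mul0r// eq_sym.
Qed.

Lemma dotv_diagE W u v : is_diag_mx W ->
  dotv u (W *m v) = \sum_(l < d) W l l * (u l ord0 * v l ord0).
Proof.
move=> Wd; rewrite dotvE; apply: eq_bigr => l _.
by rewrite mul_diag_mxE// mulrCA.
Qed.

Lemma dotvDr u v w : dotv u (v + w) = dotv u v + dotv u w.
Proof. by rewrite /dotv mulmxDr mxE. Qed.

Lemma dotvZr u a v : dotv u (a *: v) = a * dotv u v.
Proof. by rewrite /dotv -scalemxAr mxE. Qed.

Lemma diag_form_gt0 W u : is_diag_mx W -> (forall l, 0 < W l l) -> u != 0 ->
  0 < dotv u (W *m u).
Proof.
move=> Wd W_gt0 u0; rewrite dotv_diagE//.
have ge0 l : 0 <= W l l * (u l ord0 * u l ord0).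
  by rewrite mulr_ge0 ?(ltW (W_gt0 l))// -expr2 sqr_ge0.
rewrite lt_def sumr_ge0// andbT; apply: contra_neq u0.
move=> /psumr_eq0P-/(_ (fun l _ => ge0 l)) u0; apply/colP => l; rewrite mxE.
by apply/eqP; move/eqP: (u0 l isT); rewrite !mulf_eq0 orbb gt_eqF.
Qed.

Lemma dotvv_gt0 u : u != 0 -> 0 < dotv u u.
Proof.
move=> u0; rewrite -[X in dotv _ X]mul1mx; apply: diag_form_gt0 => // l.
by rewrite mxE eqxx.
Qed.

(** Evaluating the form at a basis vector reads off the diagonal entry. *)
Lemma psd_diag_gt0 W l : psd W -> is_diag_mx W -> W l l != 0 -> 0 < W l l.
Proof.
move=> [_ Wge0] Wd Wl; rewrite lt_def Wl/=.
have := Wge0 (\col_i (i == l)%:R).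
rewrite dotv_diagE// (bigD1 l)//= big1 ?addr0 => [|k /negPf kl].
  by rewrite !mxE eqxx !mulr1.
by rewrite !mxE kl !mulr0.
Qed.

Lemma norm2Z a u : norm2 (a *: u) = `|a| * norm2 u.
Proof.
rewrite /norm2 -sqrtr_sqr -sqrtrM ?sqr_ge0//; congr Num.sqrt.
by rewrite dotvZr !dotvE !mulr_sumr; apply: eq_bigr => l _; rewrite mxE; ring.
Qed.

Lemma norm2_sqr u : norm2 u ^+ 2 = \sum_(l < d) u l ord0 ^+ 2.
Proof.
rewrite sqr_sqrtr dotvE; first by apply: eq_bigr => l _; rewrite expr2.
by apply: sumr_ge0 => l _; rewrite -expr2 sqr_ge0.
Qed.

Lemma continuous_dotv u : continuous (dotv u).
Proof.
rewrite (funext (dotvE u)); apply: continuous_sum => l x.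
apply: (@continuousM R 'cV[R]_d); first exact: cst_continuous.
exact: coord_continuous.
Qed.

Lemma continuous_norm2B x : continuous (fun z => norm2 (x - z)).
Proof.
move=> z; rewrite /norm2; under eq_fun do rewrite dotvE.
apply: (@continuous_comp _ _ _
  (fun z => \sum_(l < d) (x - z) l ord0 * (x - z) l ord0) Num.sqrt).
  apply: continuous_sum z => l z.
  have cB : continuous (fun z : 'cV[R]_d => (x - z) l ord0).
    rewrite (_ : (fun _ => _) = fun z : 'cV[R]_d => x l ord0 - z l ord0).
      move=> z'; apply: (@continuousB R R^o 'cV[R]_d).
        exact: cst_continuous.
      exact: coord_continuous.
    by apply/funext => z'; rewrite !mxE.
  by apply: (@continuousM R 'cV[R]_d); exact: cB.
exact: sqrt_continuous.
Qed.

Lemma convex_open_halfspace w y :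
  convex_set [set z : 'cV[R]_d | dotv w y < dotv w z].
Proof.
apply/convex_setW => z1 z2 /set_mem/= wz1 /set_mem/= wz2 k k0 k1.
(* The abstract convex combination of [z1] and [z2] is this vector. *)
apply/mem_set; change (dotv w y < dotv w (k%:num *: z1 + (1 - k%:num) *: z2)).
rewrite dotvDr !dotvZr.
have -> : dotv w y = k%:num * dotv w y + (1 - k%:num) * dotv w y by ring.
by rewrite ltrD// ltr_pM2l// subr_gt0.
Qed.

(** Replaces [u] by a nonzero vector when [u = 0], keeping the order of the
    values at [x] and [y]; the two cases of the proof of the separation then
    become one. *)
Lemma exists_direction u x y : (0 < d)%N -> dotv u x <= dotv u y ->
  exists v, [/\ v != 0, dotv v x <= dotv v y & u = v \/ u = 0].
Proof.
move=> d_gt0 uxy; have [u0|u0] := eqVneq u 0; last first.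
  by exists u; split=> //; left.
pose e : 'cV[R]_d := const_mx 1.
have e0 : e != 0.
  apply/eqP => /colP/(_ (Ordinal d_gt0)); rewrite !mxE => /eqP.
  by rewrite oner_eq0.
have [exy|/ltW exy] := leP (dotv e x) (dotv e y).
  by exists e; split=> //; right.
exists (- e); split; [by rewrite oppr_eq0| |by right].
have dotNe v : dotv (- e) v = - dotv e v by rewrite /dotv linearN mulNmx mxE.
by rewrite !dotNe lerN2.
Qed.

Lemma exists_above u y (delta : R) : u != 0 -> 0 < delta ->
  exists2 z, norm2 (y - z) < delta & dotv u y < dotv u z.
Proof.
move=> u0 delta0; have uu := dotvv_gt0 u0.
have nu : 0 < norm2 u by rewrite sqrtr_gt0.
pose t := delta / 2 / norm2 u.
have t0 : 0 < t by rewrite !divr_gt0.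
exists (y + t *: u); last by rewrite dotvDr dotvZr ltrDl mulr_gt0.
rewrite opprD addNKr -scaleNr norm2Z normrN gtr0_norm// divfK ?gt_eqF//.
by rewrite gtr_pMr// invf_lt1 ?ltr1n //.
Qed.

End coordinates.

(** * Moments and the variance loss *)

(** Both sides integrate [h] against the same measure, the sum of the scaled
    components; [msum] takes a sequence, hence the zero measure beyond [K]. *)
Lemma ge0_integral_mixture (R : realType) d (T : measurableType d) (K : nat)
    (p : 'I_K -> R) (nu : 'I_K -> {measure set T -> \bar R})
    (m : {measure set T -> \bar R}) (h : T -> \bar R) :
  (forall k, 0 <= p k) ->
  (forall A, measurable A -> (\sum_(k < K) (p k)%:E * nu k A)%E = m A) ->
  measurable_fun setT h -> (forall x, (0 <= h x)%E) ->
  (\sum_(k < K) (p k)%:E * \int[nu k]_x h x)%E = (\int[m]_x h x)%E.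
Proof.
move=> p0 mE mh h0.
pose part (n : nat) : {measure set T -> \bar R} :=
  if insub n is Some k then mscale (NngNum (p0 k)) (nu k) else mzero.
rewrite (@eq_measure_integral _ _ _ _ (msum part K)) => [|A mA _].
  rewrite ge0_integral_measure_sum//; apply: eq_bigr => k _.
  by rewrite /part valK ge0_integral_mscale.
by rewrite -mE//= /msum; apply: eq_bigr => k _; rewrite /part valK.
Qed.

Section moments.
Variables (R : realType) (d : nat).
Implicit Types (nu P : probability 'cV[R]_d R) (W : 'M[R]_d).
Implicit Types (u z : 'cV[R]_d).

Local Notation coord l := (fun x : 'cV[R]_d => x l ord0).

Lemma measurable_coordR l : measurable_fun setT (coord l).
Proof. exact: measurable_coord. Qed.

Lemma measurable_norm2_sqr :
  measurable_fun setT (fun x : 'cV[R]_d => (norm2 x ^+ 2)%:E).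
Proof.
under eq_fun do rewrite norm2_sqr.
apply/measurable_EFinP; apply: measurable_sum => l.
by apply: measurable_funX; exact: measurable_coordR.
Qed.

Lemma Lfun2_coord nu l : finite_second_moment nu -> coord l \in Lfun nu 2%:E.
Proof.
move=> nu2; rewrite inE; apply/andP; split; rewrite inE/=.
  exact: measurable_coordR.
rewrite /finite_norm unlock /Lnorm poweR_lty//.
apply: le_lt_trans nu2; apply: ge0_le_integral => //=.
- apply/measurable_EFinP; under eq_fun do rewrite powR_mulrn//.
  apply: measurable_funX; apply: measurableT_comp => //.
  exact: measurable_coordR.
- exact: measurable_norm2_sqr.
- move=> x _; rewrite lee_fin powR_mulrn// -normrX ger0_norm ?sqr_ge0//.
  rewrite norm2_sqr (bigD1 l)//= lerDl sumr_ge0// => k _.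
  exact: sqr_ge0.
Qed.

Lemma mean_coordE nu l : mean nu l ord0 = fine 'E_nu[coord l].
Proof. by rewrite mxE. Qed.

(** For diagonal [W] the loss is a weighted sum of coordinate variances. *)
Lemma variance_lossE W nu : is_diag_mx W -> (forall l, 0 <= W l l) ->
    finite_second_moment nu ->
  variance_loss W nu = (\sum_(l < d) W l l *
    (fine 'E_nu[fun x => (x l ord0 ^+ 2)%R]%E - mean nu l ord0 ^+ 2))%:E.
Proof.
move=> Wd W0 nu2; rewrite /variance_loss.
under eq_integral do rewrite dotv_diagE// -sumEFin.
rewrite ge0_integral_sum//=; last 2 first.
- move=> l; apply/measurable_EFinP/measurable_funM => //.
  under eq_fun do rewrite mxE [X in _ + X]mxE.
  by apply: measurable_funM; apply: measurable_funB => //;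
    exact: measurable_coordR.
- by move=> l x _; rewrite lee_fin mulr_ge0// -expr2 sqr_ge0.
rewrite -sumEFin; apply: eq_bigr => l _.
have X2 := Lfun2_coord l nu2.
have fE : 'E_nu[coord l]%E \is a fin_num.
  by rewrite expectation_fin_num// Lfun_subset12// fin_num_measure.
have fE2 : 'E_nu[fun x => (x l ord0 ^+ 2)%R]%E \is a fin_num.
  by rewrite expectation_fin_num//; exact: Lfun2_mul_Lfun1.
have -> : (\int[nu]_x (W l l * ((x - mean nu) l ord0 * (x - mean nu) l ord0))%:E
          = (W l l)%:E * 'V_nu[coord l])%E.
  rewrite /variance 2!unlock -ge0_integralZl//= ?lee_fin//.
  - apply: eq_integral => x _.
    by rewrite mxE [X in (_ + X)%R]mxE mean_coordE unlock.
  - apply/measurable_EFinP; apply: measurable_funM;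
      by apply: measurable_funB => //; exact: measurable_coordR.
  - by move=> x _; rewrite lee_fin -expr2 sqr_ge0.
rewrite varianceE// mean_coordE EFinM; congr (_ * _)%E.
by rewrite EFinB EFin_expe !fineK.
Qed.

Lemma integrable_coord P A l : finite_second_moment P -> measurable A ->
  P.-integrable A (EFin \o (fun z => z l ord0)).
Proof.
move=> P2 mA; apply: (@integrableS _ _ _ _ setT) => //.
apply/Lfun1_integrable/Lfun_subset12; last exact: Lfun2_coord.
by rewrite fin_num_measure.
Qed.

Lemma integrable_dotv P A u : finite_second_moment P -> measurable A ->
  P.-integrable A (EFin \o dotv u).
Proof.
move=> P2 mA; rewrite (funext (dotvE u)).
under [_ \o _]eq_fun do rewrite /= -sumEFin.
apply: integrable_sum => // l _.
have iZ := integrableZl mA (u l ord0) (integrable_coord l P2 mA).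
by apply: (eq_integrable mA) iZ => z _; rewrite /= EFinM.
Qed.

Lemma Rintegral_dotv P A u : finite_second_moment P -> measurable A ->
  \int[P]_(z in A) dotv u z =
  \sum_(l < d) u l ord0 * \int[P]_(z in A) z l ord0.
Proof.
move=> P2 mA; have iA l := integrable_coord l P2 mA.
under [RHS]eq_bigr do rewrite -RintegralZl//.
apply: EFin_inj; rewrite -sumEFin.
have iZ l : P.-integrable A (fun z => (u l ord0 * z l ord0)%:E).
  exact: integrableZl (iA l).
under [RHS]eq_bigr do rewrite fineK ?integrable_fin_num//.
rewrite -integral_sum// fineK; last first.
  by rewrite integrable_fin_num//; exact: integrable_dotv.
by apply: eq_integral => z _; rewrite dotvE sumEFin.
Qed.

End moments.

(** * Optimal decompositions maximize the spread of the means *)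

Section decompositions.
Variables (R : realType) (d K : nat) (p : 'I_K -> R) (W : 'M[R]_d).
Hypotheses (p_gt0 : forall k, 0 < p k) (Wd : is_diag_mx W).
Hypothesis W_ge0 : forall l, 0 <= W l l.
Implicit Types (pi : probability 'cV[R]_d R).
Implicit Types (nu : 'I_K -> probability 'cV[R]_d R).

Let p_ge0 k : 0 <= p k. Proof. exact/ltW. Qed.

(** Each [p_k nu_k] is dominated by [pi], so the components inherit the finite
    second moment of [pi]. *)
Lemma mixture_decomposition pi nu : finite_second_moment pi ->
  (forall A, measurable A -> (\sum_(k < K) (p k)%:E * nu k A)%E = pi A) ->
  is_decomposition pi p nu.
Proof.
move=> pi2 nuE; split=> // k; rewrite /finite_second_moment.
have int_ge0 j : (0 <= \int[nu j]_x (norm2 x ^+ 2)%:E)%E.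
  by apply: integral_ge0 => x _; rewrite lee_fin sqr_ge0.
have : ((p k)%:E * \int[nu k]_x (norm2 x ^+ 2)%:E < +oo)%E.
  apply: le_lt_trans pi2.
  have m2 := @measurable_norm2_sqr R d.
  rewrite -(ge0_integral_mixture (nu := nu) p_ge0 nuE m2).
    rewrite (bigD1 k)//= leeDl// sume_ge0// => j _.
    by rewrite mule_ge0// lee_fin.
  by move=> x; rewrite lee_fin sqr_ge0.
rewrite !ltey; apply: contra => /eqP ->.
by rewrite gt0_muley// lte_fin.
Qed.

(** Law of total variance: the second moments of the components add up to those
    of [pi], whatever the decomposition. *)
Lemma objectiveE pi nu : finite_second_moment pi -> is_decomposition pi p nu ->
  objective p (variance_loss W) nu =
  (\sum_(l < d) W l l * fine 'E_pi[fun x => (x l ord0 ^+ 2)%R] -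
   \sum_(k < K) p k * \sum_(l < d) W l l * mean (nu k) l ord0 ^+ 2)%:E.
Proof.
move=> pi2 [nu2 nuE]; rewrite /objective.
under eq_bigr do rewrite variance_lossE// -EFinM.
rewrite sumEFin; congr EFin; apply/eqP; rewrite eq_sym subr_eq; apply/eqP.
rewrite -big_split/=.
under [RHS]eq_bigr => k _.
  rewrite -mulrDr -big_split/=.
  under eq_bigr => l _ do rewrite -mulrDr subrK.
  rewrite mulr_sumr; over.
rewrite exchange_big/=; apply: eq_bigr => l _.
have fE k : 'E_(nu k)[fun x => (x l ord0 ^+ 2)%R]%E \is a fin_num.
  apply: expectation_fin_num.
  by apply: Lfun2_mul_Lfun1; exact: Lfun2_coord.
have -> : 'E_pi[fun x => (x l ord0 ^+ 2)%R]%E =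
    (\sum_(k < K) p k * fine 'E_(nu k)[fun x => (x l ord0 ^+ 2)%R])%:E.
  rewrite -sumEFin; under eq_bigr do rewrite EFinM fineK//.
  rewrite unlock -(ge0_integral_mixture (nu := nu) p_ge0 nuE)//.
    by apply/measurable_EFinP/measurable_funX; exact: measurable_coordR.
  by move=> x; rewrite lee_fin sqr_ge0.
by rewrite /= mulr_sumr; apply: eq_bigr => k _; rewrite mulrCA.
Qed.

Lemma optimal_means pi mu nu : finite_second_moment pi ->
    is_optimal_decomposition pi p (variance_loss W) mu ->
    is_decomposition pi p nu ->
  \sum_(k < K) p k * \sum_(l < d) W l l * mean (nu k) l ord0 ^+ 2 <=
  \sum_(k < K) p k * \sum_(l < d) W l l * mean (mu k) l ord0 ^+ 2.
Proof.
move=> pi2 [mud opt] nud; have := opt _ nud.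
by rewrite !(objectiveE pi2)// lee_fin lerD2l lerN2.
Qed.

End decompositions.

(** * Exchanging mass between two probability measures *)

Section exchange.
Variables (R : realType) (disp : measure_display) (T : measurableType disp).
Implicit Types (P Q nu : probability T R) (A B E : set T) (h : T -> R).

(** The measure [P - q Q(B) P|_A + q P(A) Q|_B]: the masses removed and added
    balance.  Stated with real values, so that no subtraction of measures or of
    extended reals occurs. *)
Definition is_exchange (q : R) P Q A B nu := forall E, measurable E ->
  fine (nu E) = fine (P E) +
    q * (fine (P A) * fine (Q (E `&` B)) - fine (Q B) * fine (P (E `&` A))).

Lemma fineK_probability P E : measurable E -> (fine (P E))%:E = P E.
Proof. by move=> mE; rewrite fineK// fin_num_measure. Qed.

Lemma fine_probability_le1 P E : measurable E -> fine (P E) <= 1.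
Proof. by move=> mE; rewrite -lee_fin fineK_probability// probability_le1. Qed.

(** The removed part is a fraction [q Q(B) <= 1] of the restriction of [P] to
    [A], so the exchange is a sum of nonnegative multiples of restrictions. *)
Lemma exists_exchange q P Q A B : measurable A -> measurable B -> 0 <= q <= 1 ->
  exists nu, is_exchange q P Q A B nu.
Proof.
move=> mA mB /andP[q0 q1].
have a0 : 0 <= 1 - q * fine (Q B).
  by rewrite subr_ge0 mulr_ile1// ?fine_ge0// fine_probability_le1.
have b0 : 0 <= q * fine (P A) by rewrite mulr_ge0// fine_ge0.
pose m : {measure set T -> \bar R} := measure_add (mrestr P (measurableC mA))
  (measure_add (mscale (NngNum a0) (mrestr P mA))
               (mscale (NngNum b0) (mrestr Q mB))).
have mE E : measurable E -> m E = (fine (P E) + q * (fine (P A) *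
    fine (Q (E `&` B)) - fine (Q B) * fine (P (E `&` A))))%:E.
  move=> mE; have mEA : measurable (E `&` A) by exact: measurableI.
  have mEB : measurable (E `&` B) by exact: measurableI.
  have mEC : measurable (E `&` ~` A).
    by apply: measurableI => //; exact: measurableC.
  have PE : fine (P E) = fine (P (E `&` A)) + fine (P (E `&` ~` A)).
    rewrite -fineD ?fin_num_measure// -measureU//.
      by rewrite -setIUr setUCr setIT.
    by rewrite setIACA setICr setI0.
  have -> : m E = (P (E `&` ~` A) + ((1 - q * fine (Q B))%:E * P (E `&` A) +
      (q * fine (P A))%:E * Q (E `&` B)))%E.
    by rewrite [LHS]measure_addE; congr (_ + _)%E; exact: measure_addE.
  rewrite PE.
  rewrite -(fineK_probability P mEA) -(fineK_probability P mEC).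
  rewrite -(fineK_probability Q mEB) -!EFinM -!EFinD; congr EFin.
  by rewrite /=; ring.
have m1 : m setT = 1%E.
  rewrite mE// !setTI probability_setT/=; congr EFin; ring.
(* Normalization leaves [m], of total mass 1, unchanged and makes it a
   probability. *)
exists (mnormalize m P) => E mE'.
by rewrite /= /mnormalize m1 onee_eq0/= invr1 mule1 mE.
Qed.

Lemma ge0_integral_mrestr (m : {measure set T -> \bar R}) A (mA : measurable A)
    (h : T -> \bar R) : measurable_fun setT h -> (forall x, 0 <= h x)%E ->
  (\int[mrestr m mA]_x h x = \int[m]_(x in A) h x)%E.
Proof.
move=> mh h0; have -> : (\int[mrestr m mA]_x h x =
           \int[mrestr m mA]_(x in setT `\` ~` A) h x)%E.
  apply: ge0_negligible_integral => //; first exact: measurableC.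
  by rewrite -[LHS]/(m (~` A `&` A)) setICl measure0.
rewrite setTD setCK; apply: eq_measure_integral => E mE /setIidl EA.
by rewrite -[LHS]/(m (E `&` A)) EA.
Qed.

Section integral.
Variables (q : R) (P Q nu : probability T R) (A B : set T).
Hypotheses (q_ge0 : 0 <= q) (mA : measurable A) (mB : measurable B).
Hypothesis nuE : is_exchange q P Q A B nu.

(* For nonnegative [h] the defining identity is read as an equality of two sums
   of measures, with the removed part moved to the left. *)
Let ge0_Rintegral_exchange h : (forall x, 0 <= h x) ->
  P.-integrable setT (EFin \o h) -> Q.-integrable setT (EFin \o h) ->
  (\int[nu]_x (h x)%:E = (\int[P]_x h x + q * (fine (P A) *
    \int[Q]_(x in B) h x - fine (Q B) * \int[P]_(x in A) h x))%:E)%E.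
Proof.
move=> h0 hP hQ.
have mh : measurable_fun setT (EFin \o h) by exact: measurable_int hP.
have h0' x : (0 <= (EFin \o h) x)%E by rewrite lee_fin.
have a0 : 0 <= q * fine (Q B) by rewrite mulr_ge0// fine_ge0.
have b0 : 0 <= q * fine (P A) by rewrite mulr_ge0// fine_ge0.
have eq_m E : measurable E -> E `<=` setT ->
    measure_add nu (mscale (NngNum a0) (mrestr P mA)) E =
    measure_add P (mscale (NngNum b0) (mrestr Q mB)) E.
  move=> mE _; rewrite !measure_addE /= /mscale /= /mrestr.
  have mEA : measurable (E `&` A) by exact: measurableI.
  have mEB : measurable (E `&` B) by exact: measurableI.
  rewrite -(fineK_probability P mEA) -(fineK_probability Q mEB).
  rewrite -(fineK_probability P mE) -(fineK_probability nu mE).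
  by rewrite -!EFinM -!EFinD nuE//; congr EFin; rewrite /=; ring.
have hPA : P.-integrable A (EFin \o h) by exact: integrableS hP.
have hQB : Q.-integrable B (EFin \o h) by exact: integrableS hQ.
have int_add (m m' : {measure set T -> \bar R}) D (mD : measurable D) a
    (age0 : 0 <= a) :
    (\int[measure_add m (mscale (NngNum age0) (mrestr m' mD))]_x (h x)%:E =
     \int[m]_x (h x)%:E + a%:E * \int[m']_(x in D) (h x)%:E)%E.
  rewrite ge0_integral_measure_add//; last by move=> x _; exact: h0'.
  congr (_ + _)%E.
  rewrite [LHS]ge0_integral_mscale//; last by move=> x _; exact: h0'.
  by congr (_ * _)%E; exact: ge0_integral_mrestr.
have := eq_measure_integral _ (f := EFin \o h) eq_m.
rewrite !int_add.
have -> : (\int[P]_x (h x)%:E = (\int[P]_x h x)%:E)%E.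
  by rewrite fineK//; exact: integrable_fin_num.
have -> : (\int[P]_(x in A) (h x)%:E = (\int[P]_(x in A) h x)%:E)%E.
  by rewrite fineK//; exact: integrable_fin_num.
have -> : (\int[Q]_(x in B) (h x)%:E = (\int[Q]_(x in B) h x)%:E)%E.
  by rewrite fineK//; exact: integrable_fin_num.
rewrite -!EFinM -EFinD.
move=> /(congr1 (fun y => y - (q * fine (Q B) * \int[P]_(x in A) h x)%:E)%E).
by rewrite addeK// => ->; rewrite -EFinB; congr EFin; ring.
Qed.

Lemma Rintegral_exchange h :
  P.-integrable setT (EFin \o h) -> Q.-integrable setT (EFin \o h) ->
  \int[nu]_x h x = \int[P]_x h x + q * (fine (P A) *
    \int[Q]_(x in B) h x - fine (Q B) * \int[P]_(x in A) h x).
Proof.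
move=> hP hQ.
have mh : measurable_fun setT (EFin \o h) by exact: measurable_int hP.
(* [h] is the difference of the nonnegative functions [h + |h|] and [|h|]. *)
have nP : P.-integrable setT (EFin \o (fun x => `|h x|)).
  exact: (integrable_abse hP).
have nQ : Q.-integrable setT (EFin \o (fun x => `|h x|)).
  exact: (integrable_abse hQ).
have hnu : nu.-integrable setT (EFin \o h).
  apply/integrableP; split=> //=.
  by rewrite (@ge0_Rintegral_exchange (fun x => `|h x|))// ltry.
have nnu : nu.-integrable setT (EFin \o (fun x => `|h x|)).
  exact: (integrable_abse hnu).
have DP : P.-integrable setT (EFin \o (fun x => h x + `|h x|)).
  exact: (integrableD measurableT hP nP).
have DQ : Q.-integrable setT (EFin \o (fun x => h x + `|h x|)).
  exact: (integrableD measurableT hQ nQ).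
have h0 x : 0 <= h x + `|h x| by rewrite -lerBlDl sub0r -normrN ler_norm.
have := congr1 fine (ge0_Rintegral_exchange h0 DP DQ).
have := congr1 fine (ge0_Rintegral_exchange (fun x => normr_ge0 (h x)) nP nQ).
rewrite /= -!/(Rintegral _ _ _) => n_eq.
rewrite !RintegralD//; do ?by apply: integrableS _ hP || apply: integrableS _ nP
  || apply: integrableS _ hQ || apply: integrableS _ nQ.
rewrite n_eq => /eqP; rewrite -subr_eq0 => /eqP D0.
by apply/eqP; rewrite -subr_eq0 -{}D0; apply/eqP; ring.
Qed.

End integral.

End exchange.

Section mean_exchange.
Variables (R : realType) (d : nat).
Implicit Types (P Q nu : probability 'cV[R]_d R) (A B : set 'cV[R]_d).

Definition mean_shift P Q A B : 'cV[R]_d :=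
  \col_l (fine (P A) * \int[Q]_(x in B) x l ord0 -
          fine (Q B) * \int[P]_(x in A) x l ord0).

Lemma mean_shiftN P Q A B : mean_shift Q P B A = - mean_shift P Q A B.
Proof. by apply/colP => l; rewrite !mxE opprB. Qed.

Lemma mean_exchange q P Q nu A B : measurable A -> measurable B -> 0 <= q ->
  finite_second_moment P -> finite_second_moment Q ->
  is_exchange q P Q A B nu -> mean nu = mean P + q *: mean_shift P Q A B.
Proof.
move=> mA mB q0 P2 Q2 ex; apply/colP => l.
rewrite [RHS]mxE [X in _ + X]mxE [X in q * X]mxE !mean_coordE unlock.
by apply: (Rintegral_exchange q0 mA mB ex); exact: integrable_coord.
Qed.

Lemma dotv_mean_shift P Q A B u : measurable A -> measurable B ->
  finite_second_moment P -> finite_second_moment Q ->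
  dotv u (mean_shift P Q A B) =
  fine (P A) * \int[Q]_(x in B) dotv u x -
  fine (Q B) * \int[P]_(x in A) dotv u x.
Proof.
move=> mA mB P2 Q2; rewrite !Rintegral_dotv// dotvE !mulr_sumr -sumrB.
by apply: eq_bigr => l _; rewrite mxE; ring.
Qed.

(** Moving mass from [A], where the linear form is smaller, to [B], where it is
    larger, increases its mean. *)
Lemma dotv_mean_shift_gt0 P Q A B u (s t : R) :
  measurable A -> measurable B ->
  finite_second_moment P -> finite_second_moment Q ->
  (0 < P A)%E -> (0 < Q B)%E -> s < t ->
  (forall x, A x -> dotv u x <= s) -> (forall x, B x -> t <= dotv u x) ->
  0 < dotv u (mean_shift P Q A B).
Proof.
move=> mA mB P2 Q2 PA QB st As Bt; rewrite dotv_mean_shift// subr_gt0.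
have {}PA : 0 < fine (P A) by rewrite -lte_fin fineK_probability.
have {}QB : 0 < fine (Q B) by rewrite -lte_fin fineK_probability.
have iA : \int[P]_(x in A) dotv u x <= s * fine (P A).
  rewrite -Rintegral_cst//; apply: le_Rintegral => //.
    exact: integrable_dotv.
  exact: finite_measure_integrable_cst.
have iB : t * fine (Q B) <= \int[Q]_(x in B) dotv u x.
  rewrite -Rintegral_cst//; apply: le_Rintegral => //.
    exact: finite_measure_integrable_cst.
  exact: integrable_dotv.
apply: (@le_lt_trans _ _ (fine (Q B) * (s * fine (P A)))).
  by rewrite ler_pM2l.
apply: (@lt_le_trans _ _ (fine (P A) * (t * fine (Q B)))); last first.
  by rewrite ler_pM2l.
by rewrite mulrCA [ltRHS]mulrCA [X in _ < t * X]mulrC ltr_pM2r// mulr_gt0.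
Qed.

End mean_exchange.

(** * Mass of open sets under a density bounded below *)

Section positive_mass.
Variables (R : realType) (d : nat).
Implicit Types (u x z : 'cV[R]_d) (P : probability 'cV[R]_d R).
Implicit Types (U : set 'cV[R]_d).

Lemma measurable_open_cV U : open U -> measurable U.
Proof. exact: sub_sigma_algebra. Qed.

(** Balls of the sup norm are cubes, whose measure is a product of lengths. *)
Lemma lebesgue_cV_open_gt0 U : open U -> U !=set0 -> (0 < lebesgue_cV R d U)%E.
Proof.
move=> oU [x Ux]; have /nbhs_ballP[e /= e0 eU] : nbhs x U.
  exact: open_nbhs_nbhs.
pose cube := [set y : 'cV[R]_d |
  forall l, ball (x l ord0) e (y l ord0 : measurableTypeR R)].
have mball l : measurable (ball (x l ord0) e : set (measurableTypeR R)).
  exact: measurable_ball.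
have cubeE : lebesgue_cV R d cube = (\prod_(l < d) (e *+ 2)%:E)%E.
  rewrite (lebesgue_cV_prod mball).
  by apply: eq_bigr => l _; exact: lebesgue_measure_ball (ltW e0).
have cubeB : cube = ball x e.
  apply/seteqP; split=> y /= cy; last by move=> l; exact: (cy.2 l ord0).
  by split=> // l j; rewrite (ord1 j); exact: cy.
apply: (@lt_le_trans _ _ (lebesgue_cV R d cube)).
  rewrite cubeE; elim/big_ind: _ => //= [a b|_ _]; first exact: mule_gt0.
  by rewrite lte_fin mulrn_wgt0.
apply: le_measure => //; rewrite ?inE.
- by rewrite cubeB; apply: measurable_open_cV; exact: ball_open.
- exact: measurable_open_cV.
- by rewrite cubeB.
Qed.

Lemma density_open_gt0 P f (c : R) U : is_density P f -> 0 < c ->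
  open U -> U !=set0 -> (forall z, U z -> c < f z) -> (0 < P U)%E.
Proof.
move=> [mf f0 PE] c0 oU U0 cf; have mU := measurable_open_cV oU.
rewrite PE//; apply: (@lt_le_trans _ _ (\int[lebesgue_cV R d]_(x in U) c%:E)%E).
  by rewrite integral_cst// mule_gt0//; exact: lebesgue_cV_open_gt0.
apply: ge0_le_integral => //=.
- by move=> x _; rewrite lee_fin ltW.
- by apply/measurable_EFinP; exact: measurable_funTS.
- by move=> x Ux; rewrite lee_fin ltW// cf.
Qed.

Definition ball_slab x (delta : R) u (a b : R) : set 'cV[R]_d :=
  [set z | norm2 (x - z) < delta /\ a < dotv u z < b].

Lemma open_ball_slab x delta u a b : open (ball_slab x delta u a b).
Proof.
apply: openI.
  apply: (@open_comp _ _ (fun z => norm2 (x - z)) [set r | r < delta]).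
    by move=> ? _; exact: continuous_norm2B.
  exact: open_lt.
apply: (@open_comp _ _ (dotv u) [set` `]a, b[]).
  by move=> ? _; exact: continuous_dotv.
exact: interval_open.
Qed.

Lemma interior_support_slab_gt0 P f (delta c : R) x u a b :
  is_density P f -> 0 < c -> interior_support f delta c x ->
  ball_slab x delta u a b !=set0 -> (0 < P (ball_slab x delta u a b))%E.
Proof.
move=> Pf c0 Sx AB0; apply: density_open_gt0 Pf c0 _ AB0 _.
  exact: open_ball_slab.
by move=> z [xz _]; apply: Sx; exact: ltW.
Qed.

End positive_mass.

(** * Separation of the interior supports *)

Lemma ler_sum_pair (R : numDomainType) (I : finType) (F G : I -> R) (i j : I) :
  i != j -> \sum_k F k <= \sum_k G k ->
  (forall k, k != i -> k != j -> F k = G k) -> F i + F j <= G i + G j.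
Proof.
move=> ij leFG FG; move: leFG; have splitE (H : I -> R) :
    \sum_k H k = H i + H j + \sum_(k | (k != i) && (k != j)) H k.
  by rewrite (bigD1 i)//= (bigD1 j)/= ?addrA// eq_sym.
rewrite !splitE; under eq_bigr => k /andP[ki kj] do rewrite FG//.
by rewrite lerD2r.
Qed.

Section optimality.
Variables (R : realType) (d K : nat) (pi : probability 'cV[R]_d R).
Variables (p : 'I_K -> R) (W : 'M[R]_d) (mu : 'I_K -> probability 'cV[R]_d R).
Hypotheses (pi2 : finite_second_moment pi) (p_gt0 : forall k, 0 < p k).
Hypotheses (p_sum1 : \sum_(k < K) p k = 1).
Hypotheses (Wd : is_diag_mx W) (W_gt0 : forall l, 0 < W l l).
Hypothesis mu_opt : is_optimal_decomposition pi p (variance_loss W) mu.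
Variables (i j : 'I_K) (A B : set 'cV[R]_d).
Hypotheses (ij : i != j) (mA : measurable A) (mB : measurable B).

Let p_le1 k : p k <= 1.
Proof.
rewrite -p_sum1 (bigD1 k)//= lerDl sumr_ge0// => l _; exact/ltW.
Qed.

(** The exchange between [mu i] and [mu j] with the parameters [p j] and [p i]
    preserves the mixture and moves the two means by [p j D] and [- p i D]; the
    left-hand side is the resulting change of [sum_k p_k <m_k, W m_k>], divided
    by [p i p j]. *)
Lemma optimality_exchange (D := mean_shift (mu i) (mu j) A B) :
  2 * dotv (W *m (mean (mu i) - mean (mu j))) D +
  (p i + p j) * dotv D (W *m D) <= 0.
Proof.
have [[mu2 muE] _] := mu_opt.
have pi0 := p_gt0 i; have pj0 := p_gt0 j.
have p01 k : 0 <= p k <= 1 by rewrite ltW//=.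
have [nui nuiE] := exists_exchange (mu i) (mu j) mA mB (p01 j).
have [nuj nujE] := exists_exchange (mu j) (mu i) mB mA (p01 i).
pose nu k := if k == i then nui else if k == j then nuj else mu k.
have nu_i : nu i = nui by rewrite /nu eqxx.
have nu_j : nu j = nuj by rewrite /nu eq_sym (negPf ij) eqxx.
have nu_k k : k != i -> k != j -> nu k = mu k.
  by move=> /negPf ki /negPf kj; rewrite /nu ki kj.
have nu_dec : is_decomposition pi p nu.
  apply: mixture_decomposition => // E mE; rewrite -muE//.
  rewrite (bigD1 i)//= (bigD1 j)/=; last by rewrite eq_sym.
  rewrite [RHS](bigD1 i)//= [X in _ = (_ + X)%E](bigD1 j)/=; last first.
    by rewrite eq_sym.
  rewrite !addeA; congr (_ + _)%E; last first.
    by apply: eq_bigr => k /andP[ki kj]; rewrite nu_k.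
  rewrite nu_i nu_j -(fineK_probability nui mE) -(fineK_probability nuj mE).
  rewrite -(fineK_probability (mu i) mE) -(fineK_probability (mu j) mE).
  rewrite -!EFinM -!EFinD nuiE// nujE//; congr EFin => /=; ring.
have le_sum :=
  optimal_means p_gt0 Wd (fun l => ltW (W_gt0 l)) pi2 mu_opt nu_dec.
have := ler_sum_pair ij le_sum (fun k ki kj => congr1 (fun m =>
  p k * \sum_(l < d) W l l * mean m l ord0 ^+ 2) (nu_k k ki kj)).
rewrite nu_i nu_j (mean_exchange mA mB (ltW pj0) (mu2 i) (mu2 j) nuiE).
rewrite (mean_exchange mB mA (ltW pi0) (mu2 j) (mu2 i) nujE).
rewrite (mean_shiftN (mu i)) -/D.
rewrite !mulr_sumr -!big_split/= -subr_le0 -sumrB.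
under eq_bigr => l _.
  rewrite (_ : _ - _ = p i * p j *
    (2 * (W l l * (mean (mu i) - mean (mu j)) l ord0 * D l ord0) +
     (p i + p j) * (W l l * (D l ord0 * D l ord0)))); last first.
    by move: (mean (mu i)) (mean (mu j)) (D) => ? ? ?; rewrite !mxE; ring.
  over.
rewrite -mulr_sumr pmulr_rle0 ?mulr_gt0// big_split/= -!mulr_sumr.
rewrite dotv_diagE// dotvE.
by under [X in _ -> 2 * X + _ <= _]eq_bigr do rewrite mul_diag_mxE//.
Qed.

End optimality.

Section interior_supports.
Variables (R : realType) (d K : nat) (pi : probability 'cV[R]_d R).
Variables (p : 'I_K -> R) (W : 'M[R]_d) (mu : 'I_K -> probability 'cV[R]_d R).
Variable f : 'I_K -> 'cV[R]_d -> R.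
Hypotheses (d_gt0 : (0 < d)%N).
Hypotheses (pi2 : finite_second_moment pi) (p_gt0 : forall k, 0 < p k).
Hypotheses (p_sum1 : \sum_(k < K) p k = 1).
Hypotheses (Wd : is_diag_mx W) (W_gt0 : forall l, 0 < W l l).
Hypothesis muf : forall k, is_density (mu k) (f k).
Hypothesis mu_opt : is_optimal_decomposition pi p (variance_loss W) mu.

(** Points of [S_i] and [S_j] in the wrong order along [w = W (m_i - m_j)] would
    allow an exchange near these points that improves the decomposition. *)
Lemma interior_supports_separated (i j : 'I_K) (delta c : R) x y :
  i != j -> 0 < delta -> 0 < c ->
  interior_support (f i) delta c x -> interior_support (f j) delta c y ->
  dotv (W *m (mean (mu i) - mean (mu j))) y <
  dotv (W *m (mean (mu i) - mean (mu j))) x.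
Proof.
set w := W *m _ => ij delta0 c0 Sx Sy; rewrite ltNge; apply/negP => wxy.
have [[mu2 _] _] := mu_opt.
have [u [u0 uxy wu]] := exists_direction d_gt0 wxy.
have [z yz uyz] := exists_above y u0 delta0.
(* Two levels strictly between [<u, y>] and [<u, z>] separate [A] from [B]. *)
pose s := (dotv u y *+ 2 + dotv u z) / 3.
pose t := (dotv u y + dotv u z *+ 2) / 3.
have [ys st tz] : [/\ dotv u y < s, s < t & t < dotv u z].
  by rewrite /s /t; split; lra.
(* The outer bounds [<u, x> - 1] and [<u, z> + 1] leave room for [x] in [A] and
   for [z] in [B]. *)
pose A := ball_slab x delta u (dotv u x - 1) s.
pose B := ball_slab y delta u t (dotv u z + 1).
have mA : measurable A by apply: measurable_open_cV; exact: open_ball_slab.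
have mB : measurable B by apply: measurable_open_cV; exact: open_ball_slab.
have A0 : (0 < mu i A)%E.
  apply: interior_support_slab_gt0 (muf i) c0 Sx _; exists x; split.
    by rewrite subrr /norm2 dotvE big1 ?sqrtr0// => l _; rewrite mxE mul0r.
  by rewrite ltrBlDr ltrDl ltr01 (le_lt_trans uxy).
have B0 : (0 < mu j B)%E.
  apply: interior_support_slab_gt0 (muf j) c0 Sy _; exists z; split=> //.
  by rewrite tz ltrDl ltr01.
have := optimality_exchange pi2 p_gt0 p_sum1 Wd W_gt0 mu_opt ij mA mB.
set D := mean_shift _ _ _ _; rewrite -/w => opt.
have uD : 0 < dotv u D.
  apply: dotv_mean_shift_gt0 A0 B0 st _ _ => //.
    by move=> v [_ /andP[_ /ltW]].
  by move=> v [_ /andP[/ltW]].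
have wD : 0 <= dotv w D.
  by case: wu => ->; [exact: ltW|rewrite /dotv linear0 mul0mx mxE].
have qD : 0 < dotv D (W *m D).
  apply: diag_form_gt0 => //; apply: contraTneq uD => ->.
  by rewrite /dotv mulmx0 mxE ltxx.
move: opt; apply/negP; rewrite -ltNge ltr_wpDl// ?mulr_ge0//.
by rewrite mulr_gt0// addr_gt0.
Qed.

End interior_supports.

Theorem lemma1 (R : realType) (d K : nat) (hd : (0 < d)%N) (hK : (0 < K)%N)
  (pi : probability 'cV[R]_d R) (hpi : finite_second_moment pi)
  (p : 'I_K -> R) (hp : forall k, 0 < p k) (hp1 : \sum_(k < K) p k = 1)
  (W : 'M[R]_d) (hWpsd : psd W) (hWdiag : is_diag_mx W)
  (hW0 : forall i, W i i != 0)
  (mu : 'I_K -> probability 'cV[R]_d R) (f : 'I_K -> 'cV[R]_d -> R)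
  (hf : forall k, is_density (mu k) (f k))
  (hmu : is_optimal_decomposition pi p (variance_loss W) mu)
  (delta c : R) (hdelta : 0 < delta) (hc : 0 < c) :
  convex_in_pairs (fun k => interior_support (f k) delta c).
Proof.
move=> i j ij; apply/seteqP; split=> // y [Cy Sy].
have W_gt0 l := psd_diag_gt0 hWpsd hWdiag (hW0 l).
pose w := W *m (mean (mu i) - mean (mu j)).
have sep : Defs.conv (interior_support (f i) delta c) `<=`
    [set z | dotv w y < dotv w z].
  apply: smallest_sub; first exact: convex_open_halfspace.
  move=> x Sx.
  exact: (interior_supports_separated hd hpi hp hp1 hWdiag W_gt0 hf hmu
    ij hdelta hc Sx Sy).
by have := sep y Cy; rewrite /= ltxx.
Qed.
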